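(* Let $(X,Y)$ be a pair of random variables on finite sets $\mathcal{X}\times\mathcal{Y}$ inducing a pair of stationary memoryless sources, let $\hat{\mathcal{X}}$ be a finite set, and let $c:\mathcal{X}\times\hat{\mathcal{X}}\to[0,\infty)$ be an arbitrary function inducing the additive cost $c_n(x^n,\hat x^n)=\frac1n\sum_{i=1}^nc(x_i,\hat x_i)$. For any integer $n\ge1$ and any real number $\epsilon\ge0$, the non-asymptotic minimum average cost satisfies $$C_{\rm a}^{*}(n,\epsilon)=\min_{\substack{\hat X:\ Y-X-\hat X,\\ I(Y;\hat X)\le\frac{\epsilon}{n}}}\mathrm{E}[c(X,\hat X)],$$ where the minimum is over all random variables $\hat X$ on $\hat{\mathcal{X}}$, jointly distributed with $(X,Y)$, such that $Y-X-\hat X$ is a Markov chain and $I(Y;\hat X)\le\epsilon/n$.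
   Context: $\mathcal{X},\mathcal{Y},\hat{\mathcal{X}}$ are finite nonempty sets; $I(\cdot;\cdot)$ is mutual information (natural logarithm). The stationary memoryless sources induced by $(X,Y)$: $(X_1,Y_1),(X_2,Y_2),\dots$ are independent copies of $(X,Y)$, and $X^n=(X_1,\dots,X_n)$, $Y^n=(Y_1,\dots,Y_n)$. A stochastic encoder $f_n:\mathcal{X}^n\to\hat{\mathcal{X}}^n$ is a random map, i.e. given by a conditional probability distribution on $\hat{\mathcal{X}}^n$ given $x^n\in\mathcal{X}^n$; its output $f_n(X^n)$ depends on $(X^n,Y^n)$ only through $X^n$, so $Y^n-X^n-f_n(X^n)$ is a Markov chain. For an integer $n\ge1$ and reals $\Gamma,\epsilon\ge0$, $\Gamma$ is $(n,\epsilon)$-strongly achievable in the sense of the average cost if there exists a stochastic encoder $f_n$ with $I(Y^n;f_n(X^n))\le\epsilon$ and $\mathrm{E}[c_n(X^n,f_n(X^n))]\le\Gamma$. Define $C_{\rm a}^*(n,\epsilon)=\inf\{\Gamma\ge 0:\Gamma\text{ is }(n,\epsilon)\text{-strongly achievable in the sense of the average cost}\}$. *)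

(* Defs.v *)
From HB Require Import structures.
From mathcomp Require Import all_boot all_order all_algebra.
From mathcomp Require Import boolp classical_sets reals exp.

Set Implicit Arguments.
Unset Strict Implicit.
Unset Printing Implicit Defensive.

Import Order.TTheory GRing.Theory Num.Theory.

Local Open Scope ring_scope.
Local Open Scope classical_set_scope.

Record pmf (R : realType) (T : finType) := Pmf {
  pmf_fun :> T -> R;
  pmf_ge0 : forall t, 0 <= pmf_fun t;
  pmf_sum1 : \sum_t pmf_fun t = 1 }.

(* A finite probability space is a pair (T, mu) with mu : pmf R T; a random
   variable on it with values in a finite set A is a function T -> A. *)
Section RandomVariables.
Variables (R : realType) (T : finType) (mu : pmf R T).

Definition law (A : finType) (U : T -> A) (a : A) : R :=
  \sum_(t | U t == a) mu t.

Definition expect (f : T -> R) : R := \sum_t mu t * f t.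

Definition rv_pair (A B : finType) (U : T -> A) (V : T -> B) (t : T) : A * B :=
  (U t, V t).

(* Terms with joint probability 0 contribute 0 whatever the value of ln there. *)
Definition mutual_info (A B : finType) (U : T -> A) (V : T -> B) : R :=
  \sum_(a : A) \sum_(b : B)
    law (rv_pair U V) (a, b)
      * ln (law (rv_pair U V) (a, b) / (law U a * law V b)).

(* U - V - W: given V, the variables U and W are conditionally independent. *)
Definition markov_chain (A B C : finType)
    (U : T -> A) (V : T -> B) (W : T -> C) : Prop :=
  forall a b c, law V b != 0 ->
    law (rv_pair (rv_pair U W) V) ((a, c), b) / law V b =
    (law (rv_pair U V) (a, b) / law V b) * (law (rv_pair W V) (c, b) / law V b).

End RandomVariables.

Section Memoryless.
Variables (R : realType) (S : finType) (P : pmf R S) (n : nat).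

Definition iid_fun (s : {ffun 'I_n -> S}) : R := \prod_(i < n) P (s i).

Lemma iid_ge0 s : 0 <= iid_fun s.
Proof. by apply: prodr_ge0 => i _; exact: pmf_ge0. Qed.

Lemma iid_sum1 : \sum_s iid_fun s = 1.
Proof.
rewrite /iid_fun -(bigA_distr_bigA (fun (_ : 'I_n) (x : S) => P x)) /=.
by apply: big1 => i _; exact: pmf_sum1.
Qed.

Definition iid : pmf R {ffun 'I_n -> S} := Pmf iid_ge0 iid_sum1.

End Memoryless.

(* A conditional distribution on xhat^n given x^n. *)
Definition encoder (R : realType) (X Xh : finType) (n : nat) : Type :=
  {ffun 'I_n -> X} -> pmf R {ffun 'I_n -> Xh}.

(* Sample points are pairs ((x_i, y_i)_i, xhat^n), where xhat^n is drawn from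
   the encoder applied to x^n. *)
Section EncodedSource.
Variables (R : realType) (X Y Xh : finType) (P : pmf R (X * Y)%type) (n : nat).
Variable f : encoder R X Xh n.

Definition enc_space : finType :=
  ({ffun 'I_n -> X * Y} * {ffun 'I_n -> Xh})%type.

Definition enc_X (w : enc_space) : {ffun 'I_n -> X} := [ffun i => (w.1 i).1].
Definition enc_Y (w : enc_space) : {ffun 'I_n -> Y} := [ffun i => (w.1 i).2].
Definition enc_out (w : enc_space) : {ffun 'I_n -> Xh} := w.2.

Definition enc_fun (w : enc_space) : R := iid P n w.1 * f (enc_X w) (enc_out w).

Lemma enc_ge0 w : 0 <= enc_fun w.
Proof. by apply: mulr_ge0; exact: pmf_ge0. Qed.

Lemma enc_sum1 : \sum_w enc_fun w = 1.
Proof.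
rewrite -(pmf_sum1 (iid P n)).
rewrite -(pair_bigA _ (fun s z => enc_fun (s, z))) /=.
apply: eq_bigr => s _; rewrite /enc_fun /= -mulr_sumr.
by rewrite (pmf_sum1 (f [ffun i => (s i).1])) mulr1.
Qed.

Definition enc_law : pmf R enc_space := Pmf enc_ge0 enc_sum1.

End EncodedSource.

Definition additive_cost (R : realType) (X Xh : finType) (c : X -> Xh -> R)
    (n : nat) (x : {ffun 'I_n -> X}) (xh : {ffun 'I_n -> Xh}) : R :=
  n%:R^-1 * \sum_(i < n) c (x i) (xh i).

Definition strongly_achievable (R : realType) (X Y Xh : finType)
    (P : pmf R (X * Y)%type) (c : X -> Xh -> R) (n : nat) (eps Gamma : R)
    : Prop :=
  exists f : encoder R X Xh n,
    mutual_info (enc_law P f) (@enc_Y X Y Xh n) (@enc_out X Y Xh n) <= eps /\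
    expect (enc_law P f) (fun w => additive_cost c (enc_X w) (enc_out w))
      <= Gamma.

Definition min_avg_cost (R : realType) (X Y Xh : finType)
    (P : pmf R (X * Y)%type) (c : X -> Xh -> R) (n : nat) (eps : R) : R :=
  inf [set Gamma : R | 0 <= Gamma /\ strongly_achievable P c n eps Gamma].

(* A variable on Xh jointly distributed with (X, Y) is given by the joint
   law Q of the triple ((x, y), xhat), whose (X, Y)-marginal must be P. *)
Definition single_letter_costs (R : realType) (X Y Xh : finType)
    (P : pmf R (X * Y)%type) (c : X -> Xh -> R) (delta : R) : set R :=
  [set m : R | exists Q : pmf R (X * Y * Xh)%type,
    [/\ law Q (fun w => w.1) =1 P,
        markov_chain Q (fun w => w.1.2) (fun w => w.1.1) (fun w => w.2),
        mutual_info Q (fun w => w.1.2) (fun w => w.2) <= delta &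
        m = expect Q (fun w => c w.1.1 w.2)]].

Definition is_minimum (R : realType) (A : set R) (m : R) : Prop :=
  A m /\ lbound A m.

(* Main.v *)
(** For an encoder [f], the resampled coordinate laws average to a one-letter
    channel [avg_chan f] under which additive functionals of [(x_i, y_i, xhat_i)]
    have the same mean as under [f]; in particular the cost is preserved. Writing
    [r] for the information density of [Y] and [Xhat] under this channel, the
    product of the [r (y_i, xhat_i)] is a sub-normalised density with respect to
    the product of the laws of [Y^n] and [f(X^n)], because [Y^n] is memoryless.
    Gibbs' inequality then gives [n I(Y; Xhat) <= I(Y^n; f(X^n))] in one step,
    without the chain rule or convexity of mutual information. Conversely, a
    product encoder has [avg_chan] equal to its letter channel and attains
    equality. The minimum exists since the channels with [I(Y; Xhat) <= eps / n]
    form a compact set: [x ln x] is continuous at 0. *)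

Require Import Defs.
From HB Require Import structures.
From mathcomp Require Import all_boot all_order all_algebra.
From mathcomp Require Import boolp classical_sets reals exp.
From mathcomp Require Import topology normedtype derive realfun.

Import Order.TTheory GRing.Theory Num.Theory.

Local Open Scope ring_scope.

(** * Continuity of [x ln x] on the whole real line *)

Section XLnX.
Import numFieldNormedType.Exports.
Local Open Scope classical_set_scope.
Context {R : realType}.
Set Implicit Arguments.
Unset Strict Implicit.

(** With [s] the square root of [x], [x ln x] is [2 s (s ln s)], and [|s ln s|] is at most 1 since
    [ln (1/s) < 1/s]. *)
Lemma abs_xlnx_le (x : R) : 0 < x -> x <= 1 -> `|x * ln x| <= 2 * Num.sqrt x.
Proof.
move=> x0 x1; set s := Num.sqrt x.
have s0 : 0 < s by rewrite sqrtr_gt0.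
have xs : x = s ^+ 2 by rewrite sqr_sqrtr // ltW.
rewrite xs lnXn // normrM (ger0_norm (sqr_ge0 _)) expr2 -mulrA [leRHS]mulrC.
rewrite ler_pM2l // mulr2n ler0_norm; last first.
  have s1 : s <= 1 by rewrite -sqrtr1 ler_wsqrtr.
  by rewrite -mulr2n mulrn_wle0 // ln_le0.
have sln : s * - ln s <= 1.
  rewrite -lnV ?posrE // -ler_pdivlMl // mulr1.
  by rewrite ltW // ln_sublinear // invr_gt0.
by rewrite opprD mulrDr [leRHS](_ : 2 = 1 + 1) ?lerD.
Qed.

Lemma abs_xlnx_small (e y : R) :
  0 < e -> y < 1 -> y < (e / 2) ^+ 2 -> `|y * ln y| <= e.
Proof.
move=> e0 y1 ye.
(* [ln] is 0 on nonpositive reals. For positive [y], the threshold [(e / 2) ^+ 2] is where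
   [2 * Num.sqrt y] reaches [e]. *)
have [y0|y0] := leP y 0; first by rewrite ln0 // mulr0 normr0 ltW.
apply: le_trans (abs_xlnx_le y0 (ltW y1)) _.
rewrite mulrC -ler_pdivlMr // -[leRHS]ger0_norm ?divr_ge0 ?(ltW e0) //.
by rewrite -sqrtr_sqr ler_wsqrtr // ltW.
Qed.

Lemma xlnx_continuous : continuous (fun x : R => x * ln x).
Proof.
move=> x; have [x0|x0|->] := ltgtP x 0.
- rewrite /continuous_at (ln0 (ltW x0)) mulr0; apply: cvg_near_cst.
  near=> y; rewrite ln0 ?mulr0 // ltW //; near: y; exact: lt_nbhsl.
- by apply: continuousM; [exact: cvg_id|exact: continuous_ln].
rewrite /continuous_at mul0r; apply/cvgr0Pnorm_le => e e0; near=> y.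
apply: abs_xlnx_small => //; near: y; apply: lt_nbhsl => //.
by rewrite exprn_gt0 ?divr_gt0.
Unshelve. all: by end_near.
Qed.

Lemma continuous_sum (T : topologicalType) (I : finType) (D : pred I)
    (F : I -> T -> R) :
  (forall i, continuous (F i)) -> continuous (fun t => \sum_(i | D i) F i t).
Proof. by move=> Fc; apply: continuous_big => //; exact: add_continuous. Qed.

Lemma continuous_sumM (T : topologicalType) (I : finType) (D : pred I)
    (F G : I -> T -> R) :
  (forall i, continuous (F i)) -> (forall i, continuous (G i)) ->
  continuous (fun t => \sum_(i | D i) F i t * G i t).
Proof.
move=> Fc Gc; apply: continuous_sum => i t.
by apply: continuousM; [exact: Fc|exact: Gc].
Qed.

Lemma continuous_sum_xlnx (T : topologicalType) (I : finType) (F : I -> T -> R) :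
  (forall i, continuous (F i)) ->
  continuous (fun t => \sum_i F i t * ln (F i t)).
Proof.
move=> Fc; apply: continuous_sum => i t.
apply: (@continuous_comp _ _ _ (F i) (fun x => x * ln x)); first exact: Fc.
exact: xlnx_continuous.
Qed.

End XLnX.

(** * Laws and expectations on finite spaces *)

Section FiniteProbability.
Set Implicit Arguments.
Unset Strict Implicit.
Unset Printing Implicit Defensive.
Context {R : realType}.

Lemma pmf_ext (T : finType) (p q : pmf R T) : p =1 q -> p = q.
Proof.
case: p q => [p p0 p1] [q q0 q1] /= /funext pq; subst q.
by congr Pmf; exact: Prop_irrelevance.
Qed.

Lemma expect_sum (T I : finType) (mu : pmf R T) (h : I -> T -> R) :
  expect mu (fun t => \sum_i h i t) = \sum_i expect mu (h i).
Proof.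
by rewrite /expect exchange_big; apply: eq_bigr => t _; rewrite mulr_sumr.
Qed.

Lemma expectZ (T : finType) (mu : pmf R T) (k : R) (h : T -> R) :
  expect mu (fun t => k * h t) = k * expect mu h.
Proof. by rewrite /expect mulr_sumr; apply: eq_bigr => t _; rewrite mulrCA. Qed.

Lemma expect_ge0 (T : finType) (mu : pmf R T) (h : T -> R) :
  (forall t, 0 <= h t) -> 0 <= expect mu h.
Proof. by move=> h0; apply: sumr_ge0 => t _; rewrite mulr_ge0 ?pmf_ge0. Qed.

Lemma eq_expect (T : finType) (mu : pmf R T) (h k : T -> R) :
  (forall t, 0 < mu t -> h t = k t) -> expect mu h = expect mu k.
Proof.
move=> hk; apply: eq_bigr => t _.
have [->|t0] := eqVneq (mu t) 0; first by rewrite !mul0r.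
by rewrite hk // lt0r t0 pmf_ge0.
Qed.

Lemma expect_law (T A : finType) (mu : pmf R T) (U : T -> A) (g : A -> R) :
  expect mu (fun t => g (U t)) = \sum_a law mu U a * g a.
Proof.
rewrite /expect (partition_big U xpredT) //=; apply: eq_bigr => a _.
by rewrite /law mulr_suml; apply: eq_bigr => t /eqP ->.
Qed.

Lemma law_ge0 (T A : finType) (mu : pmf R T) (U : T -> A) a : 0 <= law mu U a.
Proof. by apply: sumr_ge0 => t _; exact: pmf_ge0. Qed.

Lemma law_sum1 (T A : finType) (mu : pmf R T) (U : T -> A) :
  \sum_a law mu U a = 1.
Proof. by rewrite -(pmf_sum1 mu) [RHS](partition_big U xpredT). Qed.

Lemma le_law (T A : finType) (mu : pmf R T) (U : T -> A) t :
  mu t <= law mu U (U t).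
Proof.
by rewrite /law (bigD1 t) //= lerDl sumr_ge0 // => s _; exact: pmf_ge0.
Qed.

Lemma lawE (T A : finType) (mu : pmf R T) (U : T -> A) a :
  law mu U a = expect mu (fun t => (U t == a)%:R).
Proof.
rewrite /law big_mkcond /=; apply: eq_bigr => t _.
by case: eqP; rewrite ?mulr1 ?mulr0.
Qed.

Lemma law_fst (T A B : finType) (mu : pmf R T) (U : T -> A) (V : T -> B) a :
  law mu U a = \sum_b law mu (rv_pair U V) (a, b).
Proof.
by rewrite /law (partition_big V xpredT).
Qed.

Lemma law_snd (T A B : finType) (mu : pmf R T) (U : T -> A) (V : T -> B) b :
  law mu V b = \sum_a law mu (rv_pair U V) (a, b).
Proof.
rewrite /law (partition_big U xpredT) //=.
by apply: eq_bigr => a _; apply: eq_bigl => t; rewrite andbC.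
Qed.

Lemma dirac_sum1 (T : finType) (a : T) : \sum_t (t == a)%:R = 1 :> R.
Proof. by rewrite (bigD1 a) //= eqxx big1 ?addr0 // => t /negPf ->. Qed.

Definition dirac_pmf {T : finType} (a : T) : pmf R T :=
  Pmf (fun t => ler0n R (t == a)) (dirac_sum1 a).

(** The product form also covers [b] of probability 0: there every law satisfies the identity, and a
    Dirac mass is chosen, which requires a point of [A]. *)
Lemma cond_pmf (T A B : finType) (A0 : (0 < #|A|)%N) (mu : pmf R T)
    (U : T -> A) (V : T -> B) b :
  exists k : pmf R A,
    forall a, law mu (rv_pair U V) (a, b) = law mu V b * k a.
Proof.
have [b0|b0] := eqVneq (law mu V b) 0.
  have /card_gt0P[a0 _] := A0; exists (dirac_pmf a0) => a; rewrite b0 mul0r.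
  apply/eqP; rewrite eq_le law_ge0 andbT -b0 (law_snd mu U V) (bigD1 a) //= lerDl.
  by rewrite sumr_ge0 // => *; exact: law_ge0.
have k0 a : 0 <= law mu (rv_pair U V) (a, b) / law mu V b.
  by rewrite divr_ge0 ?law_ge0.
have k1 : \sum_a law mu (rv_pair U V) (a, b) / law mu V b = 1.
  by rewrite -mulr_suml -law_snd divff.
by exists (Pmf k0 k1) => a /=; rewrite mulrC divfK.
Qed.

(** * Information density and Gibbs' inequality *)

Definition info_ratio {T A B : finType} (mu : pmf R T) (U : T -> A) (V : T -> B)
    (a : A) (b : B) : R :=
  law mu (rv_pair U V) (a, b) / (law mu U a * law mu V b).

Lemma mutual_infoE (T A B : finType) (mu : pmf R T) (U : T -> A) (V : T -> B) :
  mutual_info mu U V = expect mu (fun t => ln (info_ratio mu U V (U t) (V t))).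
Proof.
rewrite (expect_law mu (rv_pair U V) (fun p => ln (info_ratio mu U V p.1 p.2))).
by rewrite /mutual_info pair_bigA; apply: eq_bigr => -[a b] _.
Qed.

Lemma info_ratio_ge0 (T A B : finType) (mu : pmf R T) (U : T -> A) (V : T -> B)
  a b : 0 <= info_ratio mu U V a b.
Proof. by rewrite divr_ge0 ?mulr_ge0 ?law_ge0. Qed.

Lemma info_ratio_gt0 (T A B : finType) (mu : pmf R T) (U : T -> A) (V : T -> B)
    a b :
  0 < law mu (rv_pair U V) (a, b) -> 0 < info_ratio mu U V a b.
Proof.
move=> ab; rewrite divr_gt0 // mulr_gt0 //; apply: (lt_le_trans ab).
  rewrite (law_fst _ U V) (bigD1 b) //= lerDl.
  by rewrite sumr_ge0 // => *; exact: law_ge0.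
rewrite (law_snd _ U V) (bigD1 a) //= lerDl.
by rewrite sumr_ge0 // => *; exact: law_ge0.
Qed.

(** The terms are the conditional probabilities of [a] given [b], with sum 1. Only an inequality is
    claimed because division by 0 makes the sum 0 at a null [b]. *)
Lemma sum_info_ratio_le1 (T A B : finType) (mu : pmf R T) (U : T -> A)
    (V : T -> B) b :
  \sum_a law mu U a * info_ratio mu U V a b <= 1.
Proof.
apply: (@le_trans _ _ (\sum_a law mu (rv_pair U V) (a, b) / law mu V b)).
  apply: ler_sum => a _; 
  have [->|a0] := eqVneq (law mu U a) 0; last first.
    by rewrite /info_ratio invfM mulrCA mulVKf.
  by rewrite mul0r mulr_ge0 ?invr_ge0 ?law_ge0.
rewrite -mulr_suml -law_snd.
by have [->|b0] := eqVneq (law mu V b) 0; rewrite ?mul0r ?divff.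
Qed.

Lemma mutual_info_indep (T A B : finType) (mu : pmf R T) (U : T -> A)
    (V : T -> B) :
  (forall a b, law mu (rv_pair U V) (a, b) = law mu U a * law mu V b) ->
  mutual_info mu U V = 0.
Proof.
move=> UV; rewrite /mutual_info big1 // => a _; rewrite big1 // => b _.
rewrite UV; have [->|ab] := eqVneq (law mu U a * law mu V b) 0.
  by rewrite mul0r.
by rewrite divff // ln1 mulr0.
Qed.

Lemma ln_prod (I : finType) (F : I -> R) :
  (forall i, 0 < F i) -> ln (\prod_i F i) = \sum_i ln (F i).
Proof.
move=> F0; suff [] : 0 < \prod_i F i /\ ln (\prod_i F i) = \sum_i ln (F i) by [].
elim/big_rec2 : _ => [|i x y _ [y0 yx]]; first by rewrite ln1.
by split; rewrite ?mulr_gt0 // lnM ?posrE // yx.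
Qed.

(* Gibbs' inequality in Donsker-Varadhan form. *)
Lemma expect_ln_le_mutual_info (T A B : finType) (mu : pmf R T) (U : T -> A)
    (V : T -> B) (r : A -> B -> R) :
  (forall a b, 0 <= r a b) -> (forall t, 0 < mu t -> 0 < r (U t) (V t)) ->
  \sum_a \sum_b law mu U a * law mu V b * r a b <= 1 ->
  expect mu (fun t => ln (r (U t) (V t))) <= mutual_info mu U V.
Proof.
move=> r0 rpos r1; rewrite -subr_ge0.
rewrite (expect_law mu (rv_pair U V) (fun p => ln (r p.1 p.2))).
rewrite -(pair_bigA _ (fun a b => law mu (rv_pair U V) (a, b) * ln (r a b))) /=.
rewrite /mutual_info -sumrB.
(* Termwise lower bound from [ln u <= u - 1] at [u = r a b / info_ratio mu U V a b]; the bounds add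
   up to 1 minus a sum that is at most 1. *)
apply: (@le_trans _ _ (\sum_a \sum_b (law mu (rv_pair U V) (a, b) -
                                      law mu U a * law mu V b * r a b))).
  under eq_bigr do rewrite sumrB.
  rewrite sumrB subr_ge0; under [leRHS]eq_bigr do rewrite -law_fst.
  by rewrite law_sum1.
apply: ler_sum => a _; rewrite -sumrB; apply: ler_sum => b _.
have [ab0|ab0] := eqVneq (law mu (rv_pair U V) (a, b)) 0.
  by rewrite ab0 !mul0r !sub0r oppr0 oppr_le0 !mulr_ge0 ?law_ge0.
have p0 : 0 < law mu (rv_pair U V) (a, b) by rewrite lt0r ab0 law_ge0.
have rab : 0 < r a b.
  (* A pair of positive joint probability is realised by a sample point of positive mass, where
     [rpos] applies. *)
  have /hasP[t _ /andP[/eqP[<- <-]]] :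
      has (fun t => (rv_pair U V t == (a, b)) && (0 < mu t)) (index_enum T).
    rewrite -psumr_neq0; first exact: ab0.
    by move=> t _; exact: pmf_ge0.
  exact: rpos.
have /info_ratio_gt0 q0 := p0; rewrite -/(info_ratio mu U V a b).
rewrite -mulrBr -ler_pdivrMl // mulrBr mulVf //.
rewrite -ln_div ?posrE //.
have -> : (law mu (rv_pair U V) (a, b))^-1 * (law mu U a * law mu V b * r a b)
   = r a b / info_ratio mu U V a b.
  by rewrite /info_ratio invf_div [LHS]mulrC [LHS]mulrAC [LHS]mulrC.
have := @le_ln1Dx R (r a b / info_ratio mu U V a b - 1).
rewrite addrCA subrr addr0 ltrBrDl subrr divr_gt0 // => /(_ isT).
rewrite -[r a b / _]invf_div lnV ?posrE; last exact: divr_gt0.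
by rewrite lerNl opprB.
Qed.

(* Free of quotients, hence continuous in the joint law even where some
   probabilities vanish. *)
Lemma mutual_info_entropy (T A B : finType) (mu : pmf R T) (U : T -> A)
    (V : T -> B) (p := fun a b => law mu (rv_pair U V) (a, b)) :
  mutual_info mu U V =
  \sum_a \sum_b (p a b * ln (p a b) - p a b * ln (law mu U a)) -
  \sum_b law mu V b * ln (law mu V b).
Proof.
have -> : \sum_b law mu V b * ln (law mu V b) =
    \sum_a \sum_b p a b * ln (law mu V b).
  rewrite exchange_big; apply: eq_bigr => b _.
  by rewrite -mulr_suml -law_snd.
rewrite -sumrB; apply: eq_bigr => a _; rewrite -sumrB; apply: eq_bigr => b _.
rewrite -/(p a b); have [->|ab0] := eqVneq (p a b) 0.
  by rewrite !mul0r !subr0.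
have pab : 0 < p a b by rewrite lt0r ab0 law_ge0.
have /info_ratio_gt0 := pab; rewrite pmulr_rgt0 // invr_gt0 => UV0.
have U0 : 0 < law mu U a.
  by rewrite lt0r law_ge0 andbT; apply: contraTneq UV0 => ->; rewrite mul0r ltxx.
have V0 : 0 < law mu V b by rewrite -(pmulr_rgt0 _ U0).
by rewrite ln_div ?posrE // lnM ?posrE // opprD addrA !mulrBr.
Qed.

(** * Joint law of an input and the output of a kernel *)

Section Glue.
Variables (S Z : finType) (mu : pmf R S) (K : S -> pmf R Z).

(** Both the one-letter law [chan_law] and, through [enc_lawE], the encoder law [enc_law] are
    instances, so the marginal formulas below serve for both. *)
Definition glue_fun (w : S * Z) : R := mu w.1 * K w.1 w.2.

Lemma glue_ge0 w : 0 <= glue_fun w.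
Proof. by rewrite mulr_ge0 ?pmf_ge0. Qed.

Lemma sum_glue (h : S * Z -> R) :
  \sum_w glue_fun w * h w = \sum_s mu s * \sum_z K s z * h (s, z).
Proof.
rewrite (eq_bigr (fun w => mu w.1 * K w.1 w.2 * h (w.1, w.2))); last by case.
rewrite -(pair_bigA _ (fun s z => mu s * K s z * h (s, z))) /=.
apply: eq_bigr => s _; rewrite mulr_sumr; apply: eq_bigr => z _.
by rewrite mulrA.
Qed.

Lemma glue_sum1 : \sum_w glue_fun w = 1.
Proof.
have := sum_glue (fun=> 1); under eq_bigr do rewrite mulr1; move=> ->.
rewrite -[RHS](pmf_sum1 mu); apply: eq_bigr => s _.
by rewrite -mulr_suml pmf_sum1 !mulr1.
Qed.

Definition glue : pmf R (S * Z)%type := Pmf glue_ge0 glue_sum1.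

Lemma expect_glue h :
  expect glue h = \sum_s mu s * \sum_z K s z * h (s, z).
Proof. exact: sum_glue. Qed.

Lemma law_glue_fst (A : finType) (U : S -> A) :
  law glue (fun w => U w.1) =1 law mu U.
Proof.
move=> a; rewrite !lawE expect_glue; apply: eq_bigr => s _.
by rewrite /= -mulr_suml pmf_sum1 mul1r.
Qed.

Lemma law_glue_pair (A : finType) (U : S -> A) a z :
  law glue (rv_pair (fun w => U w.1) snd) (a, z) =
  \sum_(s | U s == a) mu s * K s z.
Proof.
rewrite lawE expect_glue [RHS]big_mkcond /=; apply: eq_bigr => s _.
rewrite (bigD1 z) //= big1 => [|v /negPf vz].
  rewrite /rv_pair /= xpair_eqE eqxx andbT.
  by case: eqP; rewrite ?mulr1 ?mulr0 ?addr0 ?mulr0.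
by rewrite /rv_pair /= xpair_eqE vz andbF mulr0.
Qed.

End Glue.

(** * Product laws *)

Lemma sum_prod_family (I J : finType) (D : pred {ffun I -> J})
    (Q : I -> pred J) (F : I -> J -> R) :
  (forall s, D s <-> forall i, Q i (s i)) ->
  \sum_(s | D s) \prod_i F i (s i) = \prod_i \sum_(j | Q i j) F i j.
Proof.
move=> DQ; rewrite bigA_distr_big_dep; apply: eq_bigl => s.
by apply/idP/familyP => /DQ.
Qed.

Section ProductLaw.
Variables (S : finType) (n : nat) (p : 'I_n -> pmf R S).

Definition prod_fun (s : {ffun 'I_n -> S}) : R := \prod_i p i (s i).

Lemma prod_fun_ge0 s : 0 <= prod_fun s.
Proof. by apply: prodr_ge0 => i _; exact: pmf_ge0. Qed.

Lemma prod_fun_sum1 : \sum_s prod_fun s = 1.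
Proof.
rewrite /prod_fun -(bigA_distr_bigA p) /=.
by apply: big1 => i _; exact: pmf_sum1.
Qed.

Definition prod_pmf : pmf R {ffun 'I_n -> S} := Pmf prod_fun_ge0 prod_fun_sum1.

Lemma law_prod_pmf i : law prod_pmf (fun s : {ffun 'I_n -> S} => s i) =1 p i.
Proof.
move=> z; rewrite /law /= /prod_fun.
(* The event is a rectangle that constrains coordinate [i] alone, so all other factors sum to 1. *)
rewrite (sum_prod_family (Q := fun j a => (j == i) ==> (a == z))
  (fun j => p j : S -> R)); last first.
  move=> s; split=> [/eqP <- j|/(_ i)]; last by rewrite eqxx.
  by apply/implyP => /eqP ->.
rewrite (bigD1 i) //= [X in _ * X]big1.
  rewrite mulr1 eqxx /=; exact: big_pred1_eq.
by move=> j /negPf ->; rewrite pmf_sum1.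
Qed.

End ProductLaw.

(** * Resampling one coordinate of a memoryless word *)

Section Resampling.
Variables (S : finType) (P : pmf R S) (n : nat).

Definition resample (T : Type) (i : 'I_n) (a : T) (s : {ffun 'I_n -> T}) :
  {ffun 'I_n -> T} := [ffun j => if j == i then a else s j].

(** The words sent to [t] are those agreeing with [t] off [i]. Their free coordinate sums to 1, and
    [P a] restores the missing factor. *)
Lemma iid_resample (i : 'I_n) (a : S) (t : {ffun 'I_n -> S}) : t i = a ->
  P a * \sum_(s | resample i a s == t) iid P n s = iid P n t.
Proof.
move=> tia; rewrite /= /iid_fun.
rewrite (sum_prod_family (Q := fun j b => (j != i) ==> (b == t j))
  (fun=> P : S -> R)); last first.
  move=> s; split=> [/eqP <- j|st]; first by rewrite ffunE; case: eqP => //=.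
  apply/eqP/ffunP => j; rewrite ffunE; case: eqVneq => [->//|ji].
  by have := st j; rewrite ji => /eqP.
rewrite (bigD1 i) //= eqxx /= pmf_sum1 mul1r [RHS](bigD1 i) //= tia.
congr (_ * _).
by apply: eq_bigr => j ->; exact: big_pred1_eq.
Qed.

(** Independence of the coordinates, in a form of conditioning on letter [i] that involves no
    division and so allows [P a = 0]. *)
Lemma sum_iid_coord (i : 'I_n) (a : S) (G : {ffun 'I_n -> S} -> R) :
  \sum_(s : {ffun 'I_n -> S} | s i == a) iid P n s * G s =
  P a * \sum_s iid P n s * G (resample i a s).
Proof.
rewrite [in RHS](partition_big (resample i a)
  (fun t : {ffun 'I_n -> S} => t i == a)); last first.
  by move=> s _; rewrite ffunE eqxx.
rewrite mulr_sumr; apply: eq_bigr => t /eqP tia.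
rewrite -(iid_resample tia) -mulrA mulr_suml; congr (_ * _).
by apply: eq_bigr => s /eqP ->.
Qed.

Lemma law_iid (A : finType) (U : S -> A) (a : {ffun 'I_n -> A}) :
  law (iid P n) (fun s : {ffun 'I_n -> S} => [ffun i => U (s i)]) a =
  \prod_i law P U (a i).
Proof.
apply: (sum_prod_family (Q := fun i s => U s == a i) (fun=> P : S -> R)) => s.
split=> [/eqP <- i|sa]; first by rewrite ffunE.
by apply/eqP/ffunP => i; rewrite ffunE; exact/eqP.
Qed.

End Resampling.

(** * One-letter channels and Markov chains *)

Section Source.
Variables (X Y Xh : finType) (P : pmf R (X * Y)%type).

Definition chan_law (W : X -> pmf R Xh) : pmf R (X * Y * Xh)%type :=
  glue P (fun s => W s.1).

Definition chan_info (W : X -> pmf R Xh) : R :=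
  mutual_info (chan_law W) (fun w => w.1.2) (fun w => w.2).

Definition chan_ratio (W : X -> pmf R Xh) : Y -> Xh -> R :=
  info_ratio (chan_law W) (fun w => w.1.2) (fun w => w.2).

(** As [W] reads only [x], the triple has mass [P (x, y) * W x z], and the Markov condition reduces
    to cancelling the probability of [x]. *)
Lemma single_letter_costs_chan (c : X -> Xh -> R) (d : R) (W : X -> pmf R Xh) :
  chan_info W <= d ->
  single_letter_costs P c d (expect (chan_law W) (fun w => c w.1.1 w.2)).
Proof.
move=> Wd; exists (chan_law W); split=> //.
  by move=> a; rewrite (law_glue_fst P (fun s => W s.1) id) /law big_pred1_eq.
move=> y x z; set px := law _ _ x => px0.
have -> : law (chan_law W) (rv_pair (rv_pair (fun w => w.1.2) (fun w => w.2))
    (fun w => w.1.1)) (y, z, x) = P (x, y) * W x z.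
  rewrite /law (big_pred1 (x, y, z)) // => -[[x' y'] z'] /=.
  by rewrite !xpair_eqE; case: (x' == x) (y' == y) (z' == z) => [] [] [].
have -> : law (chan_law W) (rv_pair (fun w => w.1.2) (fun w => w.1.1)) (y, x)
    = P (x, y).
  rewrite (law_glue_fst P (fun s => W s.1) (rv_pair snd fst)).
  rewrite /law (big_pred1 (x, y)) // => -[x' y'] /=.
  by rewrite !xpair_eqE andbC.
have -> : law (chan_law W) (rv_pair (fun w => w.2) (fun w => w.1.1)) (z, x)
    = px * W x z.
  have -> : px = law P fst x by exact: (law_glue_fst P (fun s => W s.1) fst).
  transitivity (law (chan_law W) (rv_pair (fun w => w.1.1) (fun w => w.2))
    (x, z)).
    by apply: eq_bigl => -[[x' y'] z']; rewrite !xpair_eqE andbC.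
  rewrite (law_glue_pair P (fun s => W s.1) fst) /law mulr_suml.
  by apply: eq_bigr => s /eqP <-.
by rewrite [px * _]mulrC mulfK // mulrAC.
Qed.

(** [W] is the conditional law of [xhat] given [x]. The Markov condition makes [Q] factor through it
    where [x] has positive probability; elsewhere both laws vanish. *)
Lemma single_letter_costsP (c : X -> Xh -> R) (d m : R) : (0 < #|Xh|)%N ->
  single_letter_costs P c d m ->
  exists2 W, chan_info W <= d & m = expect (chan_law W) (fun w => c w.1.1 w.2).
Proof.
move=> Xh0 [Q [QP QM Qd ->]].
suff [W QW] : exists W, Q = chan_law W by rewrite QW in Qd *; exists W.
have [W QW] := choice (fun x =>
  cond_pmf Xh0 Q (fun w => w.2) (fun w : X * Y * Xh => w.1.1) x).
exists W; apply: pmf_ext => -[[x y] z] /=; rewrite /glue_fun /=.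
have Q0 t : law Q (fun w => w.1.1) t.1.1 = 0 -> Q t = 0.
  move=> t0; apply/eqP; rewrite eq_le pmf_ge0 andbT -t0.
  exact: (le_law Q (fun w : X * Y * Xh => w.1.1)).
have [px0|px0] := eqVneq (law Q (fun w => w.1.1) x) 0.
  rewrite -QP Q0 // /law big1 ?mul0r // => -[[x' y'] z'] /eqP [-> _].
  exact: Q0.
have := QM y x z px0; rewrite QW [_ * W x z]mulrC mulfK //.
have -> : law Q (rv_pair (rv_pair (fun w => w.1.2) (fun w => w.2))
    (fun w => w.1.1)) (y, z, x) = Q (x, y, z).
  rewrite /law (big_pred1 (x, y, z)) // => -[[x' y'] z'] /=.
  by rewrite !xpair_eqE; case: (x' == x) (y' == y) (z' == z) => [] [] [].
have -> : law Q (rv_pair (fun w => w.1.2) (fun w => w.1.1)) (y, x) = P (x, y).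
  by rewrite -QP; apply: eq_bigl => -[[x' y'] z']; rewrite !xpair_eqE andbC.
by rewrite mulrAC => /(divIf px0).
Qed.

(** * From an encoder to its averaged one-letter channel *)

Section Encoder.
Variables (n : nat) (f : encoder R X Xh n).

Lemma enc_lawE :
  enc_law P f = glue (iid P n) (fun s => f [ffun i => (s i).1]).
Proof. exact: pmf_ext. Qed.

(* As the source is memoryless, the law of [xhat_i] given [x_i = x] is obtained by
   overwriting coordinate [i] of a fresh source word; this avoids dividing by
   the possibly null probability of [x]. *)
Definition avg_chan_fun (x : X) (z : Xh) : R := n%:R^-1 *
  \sum_i expect (iid P n) (fun s =>
    law (f (resample i x [ffun j => (s j).1]))
        (fun v : {ffun 'I_n -> Xh} => v i) z).

Lemma avg_chan_ge0 x z : 0 <= avg_chan_fun x z.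
Proof.
rewrite mulr_ge0 ?invr_ge0 ?ler0n // sumr_ge0 // => i _.
by apply: expect_ge0 => s; exact: law_ge0.
Qed.

Hypothesis n_gt0 : (0 < n)%N.

Lemma avg_chan_sum1 x : \sum_z avg_chan_fun x z = 1.
Proof.
rewrite -mulr_sumr exchange_big /= (eq_bigr (fun=> 1)) => [|i _]; last first.
  rewrite -expect_sum /expect -[RHS](pmf_sum1 (iid P n)).
  by apply: eq_bigr => s _; rewrite law_sum1 mulr1.
by rewrite sumr_const card_ord mulVf // pnatr_eq0 -lt0n.
Qed.

Definition avg_chan (x : X) : pmf R Xh :=
  Pmf (avg_chan_ge0 x) (avg_chan_sum1 x).

(** For each [i], source words are sorted by their letter [a] at [i], and [sum_iid_coord] trades
    them for fresh words overwritten at [i]. The function [g] will be a cost, a log-density or an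
    indicator. *)
Lemma expect_enc_sum (g : X * Y -> Xh -> R) :
  expect (enc_law P f) (fun w => \sum_i g (w.1 i) (w.2 i)) =
  n%:R * expect (chan_law avg_chan) (fun w => g w.1 w.2).
Proof.
rewrite expect_glue.
under [in RHS]eq_bigr do under eq_bigr do
  rewrite /= /avg_chan_fun -mulrA mulr_suml.
under [in RHS]eq_bigr do rewrite -mulr_sumr exchange_big mulrCA mulr_sumr.
rewrite -mulr_sumr mulVKf ?pnatr_eq0 -?lt0n // exchange_big /=.
rewrite expect_sum; apply: eq_bigr => i _.
rewrite enc_lawE expect_glue.
rewrite (partition_big (fun s : {ffun 'I_n -> X * Y} => s i) xpredT) //=.
apply: eq_bigr => a _.
rewrite (eq_bigr (fun s => iid P n s *
    \sum_v f [ffun j => (s j).1] v * g a (v i))); last by move=> s /eqP ->.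
rewrite (sum_iid_coord P i a (fun s =>
  \sum_v f [ffun j => (s j).1] v * g a (v i))); congr (_ * _).
under [RHS]eq_bigr do rewrite /expect mulr_suml.
rewrite exchange_big; apply: eq_bigr => s _.
under [RHS]eq_bigr do rewrite -mulrA.
rewrite -mulr_sumr; congr (_ * _).
(* The encoder sees only the [X] part, so overwriting by [a] acts through [a.1] and the resulting
   channel ignores the [Y] letter. *)
have -> : [ffun j => (resample i a s j).1] = resample i a.1 [ffun j => (s j).1].
  by apply/ffunP => j; rewrite !ffunE; case: ifP.
exact: (expect_law _ (fun v : {ffun 'I_n -> Xh} => v i) (g a)).
Qed.

Lemma law_enc_Y (y : {ffun 'I_n -> Y}) :
  law (enc_law P f) (@enc_Y X Y Xh n) y = \prod_i law P snd (y i).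
Proof.
rewrite enc_lawE -law_iid.
exact: (law_glue_fst (iid P n) _
  (fun s : {ffun 'I_n -> X * Y} => [ffun i => (s i).2])).
Qed.

(** Applied to an indicator, [expect_enc_sum] gives the pair at coordinate [i] at least [1/n] of the
    mass of [w] under the averaged channel. This positivity lets [ln] of the product split. *)
Lemma chan_ratio_enc_gt0 w i : 0 < enc_law P f w ->
  0 < chan_ratio avg_chan (enc_Y w i) (enc_out w i).
Proof.
move=> w0; apply: info_ratio_gt0; rewrite lawE.
rewrite -(@pmulr_rgt0 _ n%:R) ?ltr0n //.
rewrite -(expect_enc_sum (fun a z => ((a.2, z) == (enc_Y w i, enc_out w i))%:R)).
apply: (lt_le_trans w0); rewrite /expect (bigD1 w) //= ler_wpDr //.
  by apply: sumr_ge0 => v _; rewrite mulr_ge0 ?enc_ge0 // sumr_ge0.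
rewrite ler_peMr ?enc_ge0 // (bigD1 i) //= ffunE eqxx lerDl.
by rewrite sumr_ge0.
Qed.

Lemma expect_enc_ln_ratio :
  expect (enc_law P f)
    (fun w => ln (\prod_i chan_ratio avg_chan (enc_Y w i) (enc_out w i))) =
  n%:R * chan_info avg_chan.
Proof.
rewrite /chan_info mutual_infoE.
rewrite -(expect_enc_sum (fun a z => ln (chan_ratio avg_chan a.2 z))).
apply: eq_expect => w w0; rewrite ln_prod; last first.
  by move=> i; exact: chan_ratio_enc_gt0.
by apply: eq_bigr => i _; rewrite ffunE.
Qed.

Lemma chan_info_le_mutual_info :
  n%:R * chan_info avg_chan <=
  mutual_info (enc_law P f) (@enc_Y X Y Xh n) (@enc_out X Y Xh n).
Proof.
rewrite -expect_enc_ln_ratio.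
apply: (expect_ln_le_mutual_info (r := fun (y : {ffun 'I_n -> Y})
  (z : {ffun 'I_n -> Xh}) => \prod_i chan_ratio avg_chan (y i) (z i))).
- by move=> y z; apply: prodr_ge0 => i _; exact: info_ratio_ge0.
- by move=> w w0; apply: prodr_gt0 => i _; exact: chan_ratio_enc_gt0.
(* For fixed [z] the law of [Y^n] is a product, so the sum over [y] factors into one-letter sums,
   each at most 1 by [sum_info_ratio_le1]. *)
rewrite exchange_big -[leRHS](law_sum1 (enc_law P f) (@enc_out X Y Xh n)).
apply: ler_sum => z _; under eq_bigr do rewrite mulrAC mulrC law_enc_Y -big_split.
rewrite -mulr_sumr ler_piMr ?law_ge0 //.
rewrite -(bigA_distr_bigA (fun i a => law P snd a * chan_ratio avg_chan a (z i))).
apply: prodr_ile1 => i _; apply/andP; split.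
  by apply: sumr_ge0 => a _; rewrite mulr_ge0 ?law_ge0 ?info_ratio_ge0.
under eq_bigr do rewrite -(law_glue_fst P (fun s => avg_chan s.1) snd).
exact: sum_info_ratio_le1.
Qed.

Lemma expect_additive_cost (c : X -> Xh -> R) :
  expect (enc_law P f) (fun w => additive_cost c (enc_X w) (enc_out w)) =
  expect (chan_law avg_chan) (fun w => c w.1.1 w.2).
Proof.
rewrite /additive_cost expectZ -[RHS](@mulKf _ n%:R) ?pnatr_eq0 -?lt0n //.
rewrite -(expect_enc_sum (fun a z => c a.1 z)); congr (_ * _).
by apply: eq_bigr => w _; congr (_ * _); apply: eq_bigr => i _; rewrite ffunE.
Qed.

End Encoder.

(** * Attainment by product encoders *)

Section ProductEncoder.
Variables (n : nat) (n_gt0 : (0 < n)%N) (W : X -> pmf R Xh).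

Definition prod_enc : encoder R X Xh n := fun x => prod_pmf (fun i => W (x i)).

(** Output letter [i] depends only on input letter [i], which is overwritten by [x], so every
    averaged term is already [W x z]. *)
Lemma avg_chan_prod_enc : avg_chan prod_enc n_gt0 = W.
Proof.
apply: funext => x; apply: pmf_ext => z /=; rewrite /avg_chan_fun.
rewrite (eq_bigr (fun=> W x z)) => [|i _].
  by rewrite sumr_const card_ord -[W x z *+ n]mulr_natl mulKf ?pnatr_eq0 -?lt0n.
rewrite /expect -[RHS]mul1r -(pmf_sum1 (iid P n)) mulr_suml.
by apply: eq_bigr => s _; rewrite law_prod_pmf ffunE eqxx.
Qed.

Lemma law_prod_enc_pair (y : {ffun 'I_n -> Y}) (z : {ffun 'I_n -> Xh}) :
  law (enc_law P prod_enc) (rv_pair (@enc_Y X Y Xh n) (@enc_out X Y Xh n))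
    (y, z) =
  \prod_i law (chan_law W) (rv_pair (fun w => w.1.2) (fun w => w.2)) (y i, z i).
Proof.
rewrite enc_lawE (law_glue_pair _ _
  (fun s : {ffun 'I_n -> X * Y} => [ffun i => (s i).2])).
under [RHS]eq_bigr do rewrite (law_glue_pair P (fun s => W s.1) snd).
rewrite -(sum_prod_family
  (D := fun s : {ffun 'I_n -> X * Y} => [ffun i => (s i).2] == y)
  (fun i s => P s * W s.1 (z i))).
  apply: eq_bigr => s _; rewrite big_split /=; congr (_ * _).
  by apply: eq_bigr => i _; rewrite ffunE.
move=> s; split=> [/eqP <- i|sy]; first by rewrite ffunE.
by apply/eqP/ffunP => i; rewrite ffunE; exact/eqP.
Qed.

Lemma law_prod_enc_out (z : {ffun 'I_n -> Xh}) :
  law (enc_law P prod_enc) (@enc_out X Y Xh n) z =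
  \prod_i law (chan_law W) (fun w => w.2) (z i).
Proof.
rewrite (law_snd _ (@enc_Y X Y Xh n)).
rewrite (eq_bigr _ (fun y _ => law_prod_enc_pair y z)).
rewrite -(bigA_distr_bigA (fun i a => law (chan_law W)
  (rv_pair (fun w => w.1.2) (fun w => w.2)) (a, z i))).
by apply: eq_bigr => i _; rewrite -law_snd.
Qed.

(** The joint law and both marginals factor over coordinates, so the true information density is the
    product density that entered Gibbs' inequality, which is then an equality. *)
Lemma mutual_info_prod_enc :
  mutual_info (enc_law P prod_enc) (@enc_Y X Y Xh n) (@enc_out X Y Xh n) =
  n%:R * chan_info W.
Proof.
have := expect_enc_ln_ratio prod_enc n_gt0; rewrite avg_chan_prod_enc => <-.
rewrite mutual_infoE; apply: eq_expect => w _; congr ln.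
rewrite /info_ratio law_prod_enc_pair law_prod_enc_out law_enc_Y.
rewrite -big_split -prodf_div /=; apply: eq_bigr => i _.
by rewrite -(law_glue_fst P (fun s => W s.1) snd).
Qed.

Lemma expect_cost_prod_enc (c : X -> Xh -> R) :
  expect (enc_law P prod_enc)
    (fun w => additive_cost c (enc_X w) (enc_out w)) =
  expect (chan_law W) (fun w => c w.1.1 w.2).
Proof. by rewrite expect_additive_cost avg_chan_prod_enc. Qed.

End ProductEncoder.

Lemma strongly_achievableP (c : X -> Xh -> R) (n : nat) (eps G : R) :
  (0 < n)%N ->
  strongly_achievable P c n eps G <->
  exists2 W, chan_info W <= eps / n%:R &
             expect (chan_law W) (fun w => c w.1.1 w.2) <= G.
Proof.
move=> n0; split=> [[f [fI fG]]|[W WI WG]].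
  exists (avg_chan f n0); last by rewrite -expect_additive_cost.
  rewrite ler_pdivlMr ?ltr0n // mulrC.
  exact: le_trans (chan_info_le_mutual_info _ _) fI.
exists (prod_enc W); rewrite mutual_info_prod_enc // expect_cost_prod_enc //.
by split=> //; rewrite mulrC -ler_pdivlMr ?ltr0n.
Qed.

(** * Compactness of the feasible channels and existence of a minimiser *)

Section Compactness.
Import numFieldNormedType.Exports.
Local Open Scope classical_set_scope.

(** Arbitrary real matrices with the product topology, so that Tychonoff's theorem applies;
    stochasticity is imposed later by closed conditions. *)
Definition kernel_space : topologicalType :=
  prod_topology (fun _ : X * Xh => R).

Lemma continuous_eval (p : X * Xh) : continuous (fun w : kernel_space => w p : R).
Proof. exact: (@proj_continuous _ (fun _ : X * Xh => R) p). Qed.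

Definition kernel_joint (w : kernel_space) (y : Y) (z : Xh) : R :=
  \sum_(s | s.2 == y) P s * w (s.1, z).

Lemma continuous_kernel_joint y z :
  continuous (fun w : kernel_space => kernel_joint w y z).
Proof.
apply: (@continuous_sumM _ kernel_space _ _ (fun s _ => P s)
  (fun s w => w (s.1, z))) => s; first exact: cst_continuous.
exact: continuous_eval.
Qed.

(** The entropy form of [chan_info] given by [mutual_info_entropy], extended to all real
    matrices. *)
Definition kernel_info (w : kernel_space) : R :=
  \sum_y \sum_z (kernel_joint w y z * ln (kernel_joint w y z)
                 - kernel_joint w y z * ln (law P snd y))
  - \sum_z (\sum_y kernel_joint w y z) * ln (\sum_y kernel_joint w y z).

Lemma continuous_kernel_info : continuous kernel_info.
Proof.
have J y z := @continuous_kernel_joint y z.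
move=> w; apply: (@continuousB _ _ kernel_space).
  apply: (@continuous_sum _ kernel_space) => y {}w; under eq_fun do rewrite sumrB.
  apply: (@continuousB _ _ kernel_space).
    exact: (@continuous_sum_xlnx _ kernel_space).
  (* The law of [Y] does not vary with the kernel, so its logarithm is a constant coefficient. *)
  apply: (@continuous_sumM _ kernel_space _ _ _
    (fun _ _ => ln (law P snd y))) => z.
    exact: J.
  exact: cst_continuous.
apply: (@continuous_sum_xlnx _ kernel_space) => z.
exact: (@continuous_sum _ kernel_space).
Qed.

Definition kernel_of (W : X -> pmf R Xh) : kernel_space := fun p => W p.1 p.2.

Lemma kernel_info_of W : kernel_info (kernel_of W) = chan_info W.
Proof.
rewrite /chan_info mutual_info_entropy.
have J y z : law (chan_law W) (rv_pair (fun w => w.1.2) (fun w => w.2)) (y, z)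
    = kernel_joint (kernel_of W) y z.
  exact: (law_glue_pair P (fun s => W s.1) snd).
congr (_ - _).
  apply: eq_bigr => y _; apply: eq_bigr => z _.
  by rewrite J (law_glue_fst P (fun s => W s.1) snd).
apply: eq_bigr => z _; rewrite (law_snd _ (fun w => w.1.2)).
by under [in RHS]eq_bigr do rewrite J.
Qed.

(** The box is compact, and the row-sum and information conditions cut out closed subsets of it. *)
Definition feasible_kernels (d : R) : set kernel_space :=
  [set w | forall p, `[0, 1] (w p)] `&`
  (\bigcap_(x in [set: X]) [set w | \sum_z w (x, z) = 1] `&`
   [set w | kernel_info w <= d]).

Lemma compact_feasible_kernels d : compact (feasible_kernels d).
Proof.
apply: compact_closedI.
  apply: (@tychonoff _ (fun _ : X * Xh => R) (fun=> `[0, 1])) => p.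
  exact: segment_compact.
apply: closedI.
  apply: closed_bigI => x _.
  apply: (@preimage_closed _ _ (fun w : kernel_space => \sum_z w (x, z))
    [set 1]); last exact: closed_eq.
  by move=> w _; apply: continuous_sum => z; exact: continuous_eval.
apply: (@preimage_closed _ _ kernel_info [set t | t <= d]); last exact: closed_le.
by move=> w _; exact: continuous_kernel_info.
Qed.

Lemma kernel_of_feasible d W : chan_info W <= d ->
  feasible_kernels d (kernel_of W).
Proof.
move=> Wd; split=> [p|] /=.
  rewrite in_itv /= pmf_ge0 -(pmf_sum1 (W p.1)) (bigD1 p.2) //= lerDl.
  by rewrite sumr_ge0 // => z _; exact: pmf_ge0.
by split=> [x _ /=|/=]; [exact: (pmf_sum1 (W x))|rewrite kernel_info_of].
Qed.

Lemma feasible_kernelP d w : feasible_kernels d w ->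
  exists2 W, chan_info W <= d & w = kernel_of W.
Proof.
move=> [/= w01 [w1 wd]].
have w0 x z : 0 <= w (x, z) by have := w01 (x, z); rewrite in_itv => /andP[].
exists (fun x => Pmf (w0 x) (w1 x I)); last by apply: funext => -[].
by rewrite -kernel_info_of (_ : kernel_of _ = w) //; apply: funext => -[].
Qed.

(** The cost is linear in the kernel, hence continuous, and attains its minimum on the compact
    feasible set, which [W0] shows to be nonempty. *)
Lemma exists_min_cost (c : X -> Xh -> R) (d : R) W0 : chan_info W0 <= d ->
  exists2 W, chan_info W <= d & forall W', chan_info W' <= d ->
    expect (chan_law W) (fun w => c w.1.1 w.2) <=
    expect (chan_law W') (fun w => c w.1.1 w.2).
Proof.
move=> W0d.
pose cost (w : kernel_space) : R :=
  \sum_s P s * \sum_z w (s.1, z) * c s.1 z.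
have costE W :
    expect (chan_law W) (fun w => c w.1.1 w.2) = cost (kernel_of W).
  exact: expect_glue.
have cost_cont : continuous cost.
  apply: (@continuous_sumM _ kernel_space _ _ (fun s _ => P s)) => s.
    exact: cst_continuous.
  apply: (@continuous_sumM _ kernel_space _ _ _ (fun z _ => c s.1 z)) => z.
    exact: continuous_eval.
  exact: cst_continuous.
have [] := @compact_EVT_min _ _ cost (feasible_kernels d).
- by exists (kernel_of W0); exact: kernel_of_feasible.
- exact: compact_feasible_kernels.
- exact: continuous_subspaceT.
move=> w /set_mem /feasible_kernelP[W Wd ->] Wmin.
exists W => // W' W'd; rewrite !costE; apply: Wmin.
exact/mem_set/kernel_of_feasible.
Qed.

End Compactness.

(** A constant output is independent of [Y]; this provides a feasible channel for every nonnegative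
    information bound. *)
Lemma chan_info_const (z : Xh) : chan_info (fun=> dirac_pmf z) = 0.
Proof.
apply: mutual_info_indep => y z'.
rewrite (law_glue_pair P (fun s => dirac_pmf z) snd) -mulr_suml.
rewrite (law_glue_fst P (fun s => dirac_pmf z) snd); congr (_ * _).
rewrite lawE expect_glue.
rewrite (eq_bigr (fun s => P s * dirac_pmf z z')) => [|s _].
  by rewrite -mulr_suml pmf_sum1 mul1r.
rewrite (bigD1 z') //= eqxx mulr1 big1 ?addr0 // => v /negPf ->.
by rewrite mulr0.
Qed.

End Source.

End FiniteProbability.

(** * Equality of the operational and one-letter minima *)

Theorem theorem3 (R : realType) (X Y Xh : finType)
    (hX : (0 < #|X|)%N) (hY : (0 < #|Y|)%N) (hXh : (0 < #|Xh|)%N)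
    (P : pmf R (X * Y)%type)
    (c : X -> Xh -> R) (hc : forall x xh, 0 <= c x xh)
    (n : nat) (hn : (1 <= n)%N) (eps : R) (heps : 0 <= eps) :
  is_minimum (single_letter_costs P c (eps / n%:R)) (min_avg_cost P c n eps).
Proof.
have /card_gt0P[z0 _] := hXh.
have [|W Wd Wmin] := @exists_min_cost _ _ _ _ P c (eps / n%:R)
  (fun=> dirac_pmf z0).
  by rewrite chan_info_const divr_ge0.
suff -> : min_avg_cost P c n eps =
    expect (chan_law P W) (fun w => c w.1.1 w.2).
  split; first exact: single_letter_costs_chan.
  by move=> m /(single_letter_costsP hXh)[W' W'd ->]; exact: Wmin.
(* The optimal one-letter cost is itself achievable, through the product encoder, so it belongs to
   the set whose infimum is taken. *)
have achW : 0 <= expect (chan_law P W) (fun w => c w.1.1 w.2) /\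
    strongly_achievable P c n eps (expect (chan_law P W) (fun w => c w.1.1 w.2)).
  by split; [exact: expect_ge0|apply/strongly_achievableP => //; exists W].
apply/eqP; rewrite eq_le; apply/andP; split.
  by apply: ge_inf achW; exists 0 => G [].
apply: lb_le_inf; first by exists (expect (chan_law P W) (fun w => c w.1.1 w.2)).
(* Any achievable [G] dominates the cost of some feasible one-letter channel, hence the minimal
   one. *)
move=> G [_ /(strongly_achievableP _ _ _ _ hn)[W' W'd]].
by apply: le_trans; exact: Wmin.
Qed.
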